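(* Let $\mathcal{F},\mathcal{F}'\subseteq\mathbb{N}\times\mathbb{N}$ be diagonally equivalent Ferrers diagrams. For all $r\in\mathbb{N}_0$ and $\ell\in\mathbb{N}$, $$|\{P\in\mathrm{NAR}(\mathcal{F},r):\mathrm{inv}(\mathcal{F},P)=\ell\}|=|\{P\in\mathrm{NAR}(\mathcal{F}',r):\mathrm{inv}(\mathcal{F}',P)=\ell\}|.$$ In particular, $R_r(\mathcal{F};q)=R_r(\mathcal{F}';q)$ for all $r\in\mathbb{N}_0$.
   Context: $\mathbb{N}$ denotes the positive integers and $\mathbb{N}_0=\mathbb{N}\cup\{0\}$; a cell $(i,j)$ lies in row $i$, column $j$. A Ferrers diagram is a finite set $\mathcal{F}\subseteq\mathbb{N}\times\mathbb{N}$ such that $(i,j)\in\mathcal{F}$ implies $(s,t)\in\mathcal{F}$ for all $1\le s\le i$, $1\le t\le j$. The $i$-th diagonal is $\Delta_i=\{(s,i-s+1):s\in\{1,\ldots,i\}\}$; $\mathcal{F},\mathcal{F}'$ are diagonally equivalent if $|\Delta_i\cap\mathcal{F}|=|\Delta_i\cap\mathcal{F}'|$ for all $i$. A placement of non-attacking rooks is a set of cells no two sharing a row or column index; $\mathrm{NAR}(\mathcal{F},r)$ is the set of such placements $P\subseteq\mathcal{F}$ with $|P|=r$. For $P\subseteq\mathbb{N}\times\mathbb{N}$, $\mathrm{ATK}(P)=\bigcup_{(a,b)\in P}\big(\{(s,b):1\le s\le a\}\cup\{(a,t):1\le t\le b\}\big)$ (the rook cells and all cells above or to the left of a rook), and $\mathrm{inv}(\mathcal{F},P)=|\mathcal{F}\setminus\mathrm{ATK}(P)|$.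 The $r$-th $q$-rook polynomial is $R_r(\mathcal{F};q)=\sum_{P\in\mathrm{NAR}(\mathcal{F},r)}q^{\mathrm{inv}(\mathcal{F},P)}\in\mathbb{Z}[q]$, with $R_r(\mathcal{F};q)=0$ if $r<0$ or $\mathrm{NAR}(\mathcal{F},r)=\emptyset$, and $R_0(\mathcal{F};q)=q^{|\mathcal{F}|}$. *)

(* Defs.v *)
From HB Require Import structures.
From mathcomp Require Import all_boot all_order all_algebra finmap.
Set Implicit Arguments. Unset Strict Implicit. Unset Printing Implicit Defensive.
Import GRing.Theory.
Local Open Scope fset_scope.
Local Open Scope nat_scope.

(* A cell (i, j) : nat * nat lies in row i, column j; rows and columns are
   numbered from 1, so a Ferrers diagram contains only positive coordinates. *)

Definition ferrers (F : {fset nat * nat}) : Prop :=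
  (forall i j, (i, j) \in F -> 0 < i /\ 0 < j) /\
  (forall i j s t, (i, j) \in F ->
     1 <= s <= i -> 1 <= t <= j -> (s, t) \in F).

Definition diagonal (i : nat) : {fset nat * nat} :=
  [fset (s, i - s + 1) | s in iota 1 i].

Definition diag_equiv (F F' : {fset nat * nat}) : Prop :=
  forall i, 0 < i -> #|` diagonal i `&` F| = #|` diagonal i `&` F'|.

Definition nonattacking (P : {fset nat * nat}) : bool :=
  [forall x : P, forall y : P, (x != y) ==>
     ((val x).1 != (val y).1) && ((val x).2 != (val y).2)].

Definition NAR (F : {fset nat * nat}) (r : nat) : {fset {fset nat * nat}} :=
  [fset P in fpowerset F | nonattacking P && (#|` P| == r)].

Definition ATK (P : {fset nat * nat}) : {fset nat * nat} :=
  \bigcup_(p <- P) ([fset (s, p.2) | s in iota 1 p.1] `|`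
                    [fset (p.1, t) | t in iota 1 p.2]).

Definition rook_inv (F P : {fset nat * nat}) : nat := #|` F `\` ATK P|.

Definition qrook (F : {fset nat * nat}) (r : nat) : {poly int} :=
  (\sum_(P <- NAR F r) 'X^(rook_inv F P))%R.

(* Main.v *)
(* Removing the top (longest) row, of length a, of a Ferrers diagram leaves a
   diagram B with R_r = q^(a-r) R_r(B) + [a-r+1]_q R_(r-1)(B).  For a diagram
   with n rows, reindex by the number k = n - r of empty rows: the recursion
   becomes f |-> (k |-> x q^k f(k-1) + (x q^(k+1) - 1)/(q-1) f(k)) with
   x = q^(a-n), and these operators commute for all x.  Hence the q-rook
   polynomials depend only on the multiset of the numbers (length of row i) + i,
   and the diagonal sizes determine this multiset. *)

Require Import Defs.
From HB Require Import structures.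
From mathcomp Require Import all_boot all_order all_algebra finmap.
From mathcomp Require Import zify ring.
Set Implicit Arguments. Unset Strict Implicit. Unset Printing Implicit Defensive.
Import GRing.Theory.
Local Open Scope fset_scope.
Local Open Scope nat_scope.

(** * Rook placements and attacked cells *)

Lemma cardfs_uniq (K : choiceType) (A : {fset K}) (s : seq K) :
  uniq s -> s =i A -> #|` A| = size s.
Proof. by move=> us sA; apply/perm_size/uniq_perm => // x; rewrite sA. Qed.

Lemma nonattackingP (P : {fset nat * nat}) :
  reflect ({in P &, injective fst} /\ {in P &, injective snd}) (nonattacking P).
Proof.
apply: (iffP idP) => [/forallP na | [inj1 inj2]].
  split=> x y xP yP exy; apply/eqP; apply: contraT => nxy;
    move: (na [` xP]) => /forallP/(_ [` yP])/implyP;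
    by rewrite -val_eqE /= nxy exy eqxx ?andbF => /(_ isT).
apply/forallP => x; apply/forallP => y; apply/implyP => nxy.
apply/andP; split; apply: contra nxy => /eqP exy; apply/eqP/val_inj.
  by apply: inj1 => //; apply: valP.
by apply: inj2 => //; apply: valP.
Qed.

Lemma in_NAR (F P : {fset nat * nat}) (r : nat) :
  (P \in NAR F r) = [&& P `<=` F, nonattacking P & #|` P| == r].
Proof. by rewrite !inE fpowersetE. Qed.

Lemma ATKP (P : {fset nat * nat}) (c : nat * nat) :
  reflect (exists2 p, p \in P & (c.2 = p.2 /\ 0 < c.1 <= p.1) \/
                                (c.1 = p.1 /\ 0 < c.2 <= p.2))
          (c \in ATK P).
Proof.
have mem_iota1 m n : (m \in iota 1 n) = (0 < m <= n) by rewrite mem_iota; lia.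
apply: (iffP (bigfcupP _ _ _ _)) => [[p /andP[pP _]]|[p pP cp]].
  by rewrite in_fsetU => /orP[]/imfsetP[s /=]; rewrite mem_iota1 => sp ->;
    exists p => //; (by left) || by right.
exists p; rewrite ?pP // in_fsetU; case: c cp => s t /= [[-> sp]|[-> tp]].
  by apply/orP; left; apply/imfsetP; exists s; rewrite //= mem_iota1.
by apply/orP; right; apply/imfsetP; exists t; rewrite //= mem_iota1.
Qed.

(** * Adding a top row to a diagram *)

Definition add_row (i a : nat) (B : {fset nat * nat}) : {fset nat * nat} :=
  [fset (i, t) | t in iota 1 a] `|` B.

Definition below_row (i a : nat) (B : {fset nat * nat}) : Prop :=
  forall p, p \in B -> i < p.1 /\ 0 < p.2 <= a.

Definition free_cols (a : nat) (P : {fset nat * nat}) : seq nat :=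
  [seq t <- iota 1 a | t \notin [seq p.2 | p <- P]].

Lemma in_add_row i a B (c : nat * nat) :
  (c \in add_row i a B) = (c.1 == i) && (0 < c.2 <= a) || (c \in B).
Proof.
rewrite in_fsetU; congr (_ || _); apply/imfsetP/idP => [[t /=]|].
  by rewrite mem_iota => ta -> /=; lia.
case: c => s t /= /andP[/eqP-> ta]; exists t => //=; rewrite mem_iota; lia.
Qed.

Lemma in_free_cols a P t :
  (t \in free_cols a P) = (t \notin [seq p.2 | p <- P]) && (0 < t <= a).
Proof. by rewrite mem_filter mem_iota add1n ltnS. Qed.

(** Non-attacking rooks occupy distinct columns, all among the first [a]. *)
Lemma size_free_cols i a (P : {fset nat * nat}) :
  below_row i a P -> nonattacking P -> size (free_cols a P) + #|` P| = a.
Proof.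
move=> Pa /nonattackingP[_ inj2].
rewrite -[RHS](size_iota 1) -[RHS](count_predC (mem [seq p.2 | p <- P])) addnC.
rewrite -!size_filter; congr addn.
rewrite -(size_map snd (enum_fset P)); apply/perm_size/uniq_perm.
- by rewrite map_inj_in_uniq ?fset_uniq.
- by rewrite filter_uniq ?iota_uniq.
move=> t; rewrite mem_filter /= andbC; symmetry.
by apply: andb_idl => /mapP[p /Pa[_]]; rewrite mem_iota add1n ltnS => pa ->.
Qed.

(** Common to the cases without and with a rook in row [i]: [E] lists the unattacked columns of that
    row, and below it [Q] attacks the same cells as [P]. *)
Lemma rook_inv_add_row i a B P Q (E : seq nat) :
    below_row i a B -> uniq E ->
    (forall t, (t \in E) = (0 < t <= a) && ((i, t) \notin ATK Q)) ->
    (forall c, c \in B -> (c \in ATK Q) = (c \in ATK P)) ->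
  rook_inv (add_row i a B) Q = size E + rook_inv B P.
Proof.
move=> Bi uE EQ QP.
rewrite /rook_inv (@cardfs_uniq _ _ ([seq (i, t) | t <- E] ++ (B `\` ATK P))).
- by rewrite size_cat size_map.
- rewrite cat_uniq fset_uniq andbT map_inj_uniq ?uE => [|x y []] //=.
  apply/hasPn => c; rewrite in_fsetD => /andP[_ /Bi[ic _]].
  by apply/mapP => -[t _ ct]; rewrite ct ltnn in ic.
move=> c; rewrite mem_cat !in_fsetD in_add_row.
have [cB|cB] := boolP (c \in B).
  rewrite QP // orbT !andbT; case: mapP => //= -[t _ ct].
  by have [] := Bi _ cB; rewrite ct ltnn.
rewrite andbF !orbF; case: c cB => s u cB /=.
apply/mapP/andP => [[t]|].
  by rewrite EQ => /andP[ta tQ] [-> ->]; rewrite eqxx.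
by move=> [sQ /andP[/eqP es ua]]; exists u; rewrite ?EQ -?es ?ua.
Qed.

(** A cell of the new row is attacked exactly when its column holds a rook of [P], since rooks
    attack upwards. *)
Lemma rook_inv_no_rook i a B P : 0 < i -> below_row i a B -> P `<=` B ->
  rook_inv (add_row i a B) P = size (free_cols a P) + rook_inv B P.
Proof.
move=> i0 Bi PB; apply: rook_inv_add_row => // [|t].
  by rewrite filter_uniq ?iota_uniq.
rewrite in_free_cols andbC; congr (_ && ~~ _).
apply/mapP/ATKP => -[p pP pt]; exists p => //=.
  by left; split=> //; have [ip _] := Bi _ (fsubsetP PB _ pP); rewrite i0 ltnW.
have [ip _] := Bi _ (fsubsetP PB _ pP).
by case: pt => -[] //= pi; rewrite -pi ltnn in ip.
Qed.

(** The new rook also attacks the cells to its left, so only free columns to its right survive. It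
    attacks nothing in [B], which lies lower. *)
Lemma rook_inv_rook i a B P t : 0 < i -> below_row i a B -> P `<=` B ->
  t \in free_cols a P ->
  rook_inv (add_row i a B) ((i, t) |` P) =
    size [seq u <- free_cols a P | t < u] + rook_inv B P.
Proof.
move=> i0 Bi PB tP; apply: rook_inv_add_row => // [|u|c cB].
- by rewrite !filter_uniq ?iota_uniq.
- rewrite mem_filter in_free_cols.
  have [ua|] := boolP (0 < u <= a); last by rewrite !andbF.
  rewrite andbT /=; apply/andP/idP => [[tu uP]|uQ].
    apply/ATKP => -[p]; rewrite !inE => /orP[/eqP->/=|pP pt]; first lia.
    have [] := Bi _ (fsubsetP PB _ pP).
    case: pt => /= -[pu]; last lia.
    by case/mapP: uP; exists p.
  split.
    rewrite ltnNge; apply: contra uQ => ut; apply/ATKP.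
    by exists (i, t); rewrite ?fset1U1 //=; right; lia.
  apply: contra uQ => /mapP[p pP up]; apply/ATKP.
  exists p; first by rewrite !inE pP orbT.
  by left; split=> //; have [ip _] := Bi _ (fsubsetP PB _ pP); rewrite i0 ltnW.
apply/ATKP/ATKP => -[p]; last by move=> pP pc; exists p => //; rewrite !inE pP orbT.
rewrite !inE => /orP[/eqP->|]; last by exists p.
have [ic _] := Bi _ cB => /= -[[_ /andP[_]]|[ci _]]; first by rewrite leqNgt ic.
by rewrite ci ltnn in ic.
Qed.

Lemma below_rowS i a (B P : {fset nat * nat}) :
  below_row i a B -> P `<=` B -> below_row i a P.
Proof. by move=> Bi /fsubsetP PB p /PB; apply: Bi. Qed.

Lemma row_notin i a B t : below_row i a B -> (i, t) \notin B.
Proof. by move=> Bi; apply/negP => /Bi[]; rewrite ltnn. Qed.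

Lemma nonattacking_add i a (P : {fset nat * nat}) t :
  below_row i a P -> nonattacking P -> t \notin [seq p.2 | p <- P] ->
  nonattacking ((i, t) |` P).
Proof.
move=> Pi /nonattackingP[inj1 inj2] tP; apply/nonattackingP.
split=> x y; rewrite !inE => /orP[/eqP->|xP] /orP[/eqP->|yP] //= exy.
- by have [] := Pi _ yP; rewrite -exy ltnn.
- by have [] := Pi _ xP; rewrite exy ltnn.
- exact: inj1.
- by case/negP: tP; apply/mapP; exists y.
- by case/negP: tP; apply/mapP; exists x.
- exact: inj2.
Qed.

Lemma nonattacking_rem c (P : {fset nat * nat}) :
  c \in P -> nonattacking P ->
  nonattacking (P `\ c) /\ c.2 \notin [seq p.2 | p <- P `\ c].
Proof.
move=> cP /nonattackingP[inj1 inj2]; split.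
  apply/nonattackingP; split=> x y; rewrite !inE => /andP[_ xP] /andP[_ yP].
    exact: inj1.
  exact: inj2.
apply/mapP => -[p]; rewrite !inE => /andP[/eqP pc pP] e; apply: pc.
exact/esym/inj2.
Qed.

(** A placement either avoids row [i] or has one rook there; removing that rook leaves a placement
    in [B] for which its column is free. *)
Lemma perm_NAR_add_row i a B r : below_row i a B ->
  perm_eq (NAR (add_row i a B) r.+1)
    (NAR B r.+1 ++ [seq (i, t) |` P | P <- NAR B r, t <- free_cols a P]).
Proof.
move=> Bi; apply: uniq_perm; first exact: fset_uniq.
  rewrite cat_uniq fset_uniq /=; apply/andP; split.
    apply/hasPn => Q /allpairsPdep[P [t [_ _ ->]]]; rewrite in_NAR.
    apply/negP => /andP[/fsubsetP/(_ (i, t))]; rewrite fset1U1 => /(_ isT).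
    by rewrite (negPf (row_notin t Bi)).
  apply: allpairs_uniq_dep => [|P _|]; first exact: fset_uniq.
    by rewrite filter_uniq ?iota_uniq.
  move=> _ _ /allpairsPdep[P [t [PB tP ->]]] /allpairsPdep[Q [u [QB uQ ->]]] /= e.
  move: PB QB; rewrite !in_NAR => /andP[PB _] /andP[QB _].
  have nB v := row_notin v Bi.
  (* [B] has no cell in row [i], so the rook in that row determines its column. *)
  have etu : t = u.
    have := fset1U1 (i, t) P; rewrite e !inE => /orP[/eqP[]|] // /(fsubsetP QB).
    by rewrite (negPf (nB t)).
  have ePQ : P = Q.
    rewrite -(fsetU1K (contra (fsubsetP PB (i, t)) (nB t))) e -etu fsetU1K //.
    exact: contra (fsubsetP QB (i, t)) (nB t).
  by rewrite etu ePQ.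
move=> Q; rewrite mem_cat !in_NAR.
apply/and3P/orP => [[QF naQ sQ]|[/and3P[QB naQ sQ]|]].
- have [/hasP[[s t] cQ /= /eqP si]|/hasPn noi] := boolP (has (fun c => c.1 == i) Q).
    rewrite {s}si in cQ; right; have [naP tP] := nonattacking_rem cQ naQ.
    have PB : Q `\ (i, t) `<=` B.
      apply/fsubsetP => p; rewrite !inE => /andP[/eqP pc pQ].
      have := fsubsetP QF _ pQ; rewrite in_add_row => /orP[/andP[/eqP pi _]|//].
      case: pc; apply: (proj1 (nonattackingP _ naQ)) => //.
    apply/allpairsPdep; exists (Q `\ (i, t)), t; rewrite fsetD1K //; split=> //.
      by rewrite in_NAR PB naP /= -eqSS -(eqP sQ) (cardfsD1 (i, t) Q) cQ.
    rewrite in_free_cols tP; have := fsubsetP QF _ cQ.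
    by rewrite in_add_row (negPf (row_notin _ Bi)) orbF eqxx.
  left; rewrite naQ sQ !andbT; apply/fsubsetP => p pQ.
  have := fsubsetP QF _ pQ; rewrite in_add_row => /orP[/andP[pi _]|//].
  by have := noi _ pQ; rewrite pi.
- by split=> //; apply: fsubset_trans QB (fsubsetUr _ _).
case/allpairsPdep=> P [t []]; rewrite in_NAR in_free_cols.
move=> /and3P[PB naP /eqP sP] /andP[tP ta] ->; split.
- apply/fsubsetP => p; rewrite in_add_row in_fset1U.
  by case/orP=> [/eqP->|/(fsubsetP PB)->]; rewrite ?orbT //= eqxx ta.
- exact: nonattacking_add (below_rowS Bi PB) naP tP.
by rewrite cardfsU1 sP (contra (fsubsetP PB _) (row_notin t Bi)).
Qed.

Lemma NAR0 F : NAR F 0 = [fset fset0].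
Proof.
apply/fsetP => P; rewrite in_NAR !inE cardfs_eq0.
have [->|] := eqVneq P fset0; last by rewrite !andbF.
rewrite fsub0set andbT; apply/nonattackingP.
by split=> x y; rewrite inE.
Qed.

(** The number of entries larger than [t] runs through [size E - 1, ..., 0] as [t] moves along the
    list. *)
Lemma sum_gt_sorted (R : comNzRingType) (q : R) (E : seq nat) : sorted ltn E ->
  (\sum_(t <- E) q ^+ size [seq u <- E | (t < u)%N] = \sum_(j < size E) q ^+ j)%R.
Proof.
elim: E => [|t E IH] /=; first by rewrite big_nil big_ord0.
rewrite path_sortedE; last exact: ltn_trans.
case/andP=> /allP tE sE.
rewrite big_cons big_ord_recr /= ltnn [RHS]addrC -IH //; congr (_ + _)%R.
  by congr (q ^+ size _)%R; apply/all_filterP/allP.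
by apply: eq_big_seq => u /tE tu; rewrite ltnNge ltnW.
Qed.

(** * The recursion for q-rook polynomials *)

Section Recursion.
Local Open Scope ring_scope.
Local Notation q := ('X : {poly int}).

(** Without a rook in row [i], the [a - r] free columns stay unattacked; with one, its position
    among the [a - r'] free columns yields a geometric sum. *)
Lemma qrook_add_row i a B r : (0 < i)%N -> below_row i a B ->
  qrook (add_row i a B) r =
    q ^+ (a - r) * qrook B r +
    (if r is r'.+1 then (\sum_(j < a - r') q ^+ j) * qrook B r' else 0).
Proof.
move=> i0 Bi.
have freeE P r' : P \in NAR B r' -> size (free_cols a P) = (a - r')%N.
  rewrite in_NAR => /and3P[PB naP /eqP sP].
  by have := size_free_cols (below_rowS Bi PB) naP; rewrite sP; lia.
have no_rook r' : \sum_(P <- NAR B r') q ^+ rook_inv (add_row i a B) P =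
    q ^+ (a - r') * qrook B r'.
  rewrite /qrook big_distrr /=; apply: eq_big_seq => P PN.
  rewrite rook_inv_no_rook ?exprD ?(freeE P r') //.
  by move: PN; rewrite in_NAR => /andP[].
case: r => [|r].
  rewrite addr0 -no_rook /qrook.
  by rewrite !NAR0.
rewrite -no_rook {1}/qrook (perm_big _ (perm_NAR_add_row r Bi)) big_cat /=.
congr (_ + _); rewrite big_allpairs_dep /qrook big_distrr /=.
apply: eq_big_seq => P PN.
have PB : P `<=` B by move: PN; rewrite in_NAR => /andP[].
rewrite -(freeE P r) // -sum_gt_sorted; last first.
  by apply: sorted_filter; [exact: ltn_trans | exact: iota_ltn_sorted].
rewrite big_distrl /=; apply: eq_big_seq => t tP.
by rewrite (rook_inv_rook i0 Bi PB tP) exprD.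
Qed.

End Recursion.

Lemma qrook_add_row0 i a B : (0 < i)%N -> below_row i a B ->
  (qrook (add_row i a B) 0 = 'X^a * qrook B 0)%R.
Proof. by move=> i0 Bi; rewrite (qrook_add_row 0 i0 Bi) subn0 addr0. Qed.

Lemma qrook_gt_width i a B r : below_row i a B -> a < r -> qrook B r = 0%R.
Proof.
move=> Bi ar; rewrite /qrook big_seq big1 // => P.
rewrite in_NAR => /and3P[PB naP /eqP sP].
by have := size_free_cols (below_rowS Bi PB) naP; lia.
Qed.

(** * Boards given by row lengths *)

(** Rows keep their absolute indices [i, ..., i + n - 1], so removing the top row needs no
    renumbering and leaves [i + n] unchanged. *)
Fixpoint board (l : nat -> nat) (i n : nat) : {fset nat * nat} :=
  if n is n'.+1 then add_row i (l i) (board l i.+1 n') else fset0.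

Lemma in_board l i n (c : nat * nat) :
  (c \in board l i n) = (i <= c.1 < i + n) && (0 < c.2 <= l c.1).
Proof.
elim: n i => [|n IH] i /=; first by rewrite inE addn0; lia.
rewrite in_add_row IH; case: eqP => [->|] /=; last by lia.
by rewrite ltnn orbF leqnn addnS ltnS leq_addr.
Qed.

Definition antitone (l : nat -> nat) := forall i j, i <= j -> l j <= l i.

Lemma below_row_board l i n : antitone l -> below_row i (l i) (board l i.+1 n).
Proof.
move=> ldec p; rewrite in_board => /andP[/andP[ip _] /andP[-> pl]]; split=> //.
by apply: leq_trans pl (ldec _ _ (ltnW ip)).
Qed.

Lemma qrook_fset0 r : qrook fset0 r = ((r == 0)%:R)%R.
Proof.
rewrite /qrook; case: r => [|r].
  by rewrite NAR0 big_seq_fset1 /rook_inv fset0D cardfs0.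
rewrite big_seq big1 // => P; rewrite in_NAR fsubset0.
by case/and3P=> /eqP-> _; rewrite cardfs0.
Qed.

Lemma qrook_gt_height l i n r :
  0 < i -> antitone l -> n < r -> qrook (board l i n) r = 0%R.
Proof.
move=> i0 ldec; elim: n i i0 r => [|n IH] i i0 [|r] //= nr.
  by rewrite qrook_fset0.
rewrite (qrook_add_row _ i0 (below_row_board ldec)) !IH ?mulr0 ?addr0 //.
exact: ltnW.
Qed.

(** * Commuting row operators *)

Section RowOperators.
Local Open Scope ring_scope.
Local Notation q := ('X : {poly int}).

(** This is the reindexed recursion with [x = q^(c - M)], multiplied by [q^M (q - 1)] to stay among
    polynomials. *)
Definition row_op (M c : nat) (G : nat -> {poly int}) (k : nat) : {poly int} :=
  (q - 1) * q ^+ c * q ^+ k * (if k is k'.+1 then G k' else 0) +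
  (q ^+ c * q ^+ k.+1 - q ^+ M) * G k.

(** [row_op M c] is [q^c A - q^M] for a linear operator [A] that does not depend on [c]. *)
Lemma row_op_comm M c d G : row_op M c (row_op M d G) =1 row_op M d (row_op M c G).
Proof.
move=> k; rewrite /row_op; move: (q ^+ c) (q ^+ d) => x y.
by case: k => [|[|k]]; ring.
Qed.

Lemma eq_row_op M c G H : G =1 H -> row_op M c G =1 row_op M c H.
Proof. by move=> GH [|k]; rewrite /row_op !GH. Qed.

(* The factor [q ^+ (M * n) * (q - 1) ^+ n] clears the denominators of the
   recursion, [M - 1] being the index of the last row of the whole diagram. *)
Definition scaled_qrook (M : nat) (l : nat -> nat) (i n k : nat) : {poly int} :=
  if (k <= n)%N then q ^+ (M * n) * (q - 1) ^+ n * qrook (board l i n) (n - k)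
  else 0.

(** With [r = n + 1 - k] rooks, the term in [R_r] of the smaller board has index [k - 1], the term
    in [R_(r-1)] index [k]. *)
Lemma scaled_qrookS M l i n : (0 < i)%N -> antitone l -> (i + n.+1 = M)%N ->
  scaled_qrook M l i n.+1 =1 row_op M (l i + i) (scaled_qrook M l i.+1 n).
Proof.
move=> i0 ldec eM k; rewrite /row_op /scaled_qrook /=.
have Bi : below_row i (l i) (board l i.+1 n) by exact: below_row_board.
set B := board l i.+1 n in Bi *.
(* If [l i < r] then [l i - r] is truncated to [0], but [qrook B r = 0]. *)
have w0 r k' : (r + k' = n.+1)%N ->
    q ^+ M * (q ^+ (l i - r) * qrook B r) = q ^+ (l i + i) * q ^+ k' * qrook B r.
  move=> rk; have [rl|lr] := leqP r (l i); last by rewrite (qrook_gt_width Bi lr) !mulr0.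
  by rewrite mulrA -!exprD; congr (q ^+ _ * _); lia.
have w1 r k' : (r + k' = n)%N ->
    q ^+ M * (q - 1) * ((\sum_(j < l i - r) q ^+ j) * qrook B r) =
    (q ^+ (l i + i) * q ^+ k'.+1 - q ^+ M) * qrook B r.
  move=> rk; have [rl|lr] := leqP r (l i); last by rewrite (qrook_gt_width Bi lr) !mulr0.
  (* Here [(q - 1)] times the geometric sum telescopes, and the exponents agree because
     [M = i + r + k' + 1]. *)
  rewrite mulrA -[_ * _ * (\sum_(_ < _) _)]mulrA -subrX1 mulrBr mulr1 -!exprD.
  by congr ((q ^+ _ - _) * _); lia.
have split_pow : q ^+ (M * n.+1) * (q - 1) ^+ n.+1 =
    q ^+ (M * n) * (q - 1) ^+ n * (q ^+ M * (q - 1)).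
  by rewrite mulnS exprD exprS; ring.
case: k => [|k].
  rewrite !subn0 mulr0 add0r /= (qrook_add_row _ i0 Bi).
  (* For [k = 0] there are [n + 1] rooks, too many for the [n] rows of [B]; this matches the missing
     index [k - 1] in [row_op]. *)
  rewrite [qrook B n.+1](qrook_gt_height (i := i.+1)) // mulr0 add0r split_pow.
  by rewrite -mulrA (w1 n 0%N) ?addn0 //; ring.
rewrite ltnS subSS; case: (ltngtP k n) => [kn|kn|->].
- rewrite -[(n - k)%N](@prednK) ?subn_gt0 // (qrook_add_row _ i0 Bi) -subnS.
  have -> : (n - k.+1).+1 = (n - k)%N by lia.
  rewrite split_pow; set W := q ^+ (M * n) * (q - 1) ^+ n.
  rewrite (_ : _ * _ = W * (q - 1) * (q ^+ M * (q ^+ (l i - (n - k)) * qrook B (n - k)))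
      + W * (q ^+ M * (q - 1) * ((\sum_(j < l i - (n - k.+1)) q ^+ j) *
          qrook B (n - k.+1)))); last by ring.
  by rewrite (w0 _ k.+1) ?(w1 _ k.+1); [ring | lia | lia].
- ring.
(* Here no rooks are placed, so only the term without a rook in the top row remains. *)
rewrite subnn (qrook_add_row0 i0 Bi) split_pow mulr0 addr0.
have := w0 0%N n.+1 erefl; rewrite subn0 => e.
have -> : q ^+ (M * n) * (q - 1) ^+ n * (q ^+ M * (q - 1)) * (q ^+ l i * qrook B 0)
  = q ^+ (M * n) * (q - 1) ^+ n * (q - 1) * (q ^+ M * (q ^+ l i * qrook B 0)) by ring.
by rewrite e; ring.
Qed.

Lemma scaled_qrook_foldr M l i n : (0 < i)%N -> antitone l -> (i + n = M)%N ->
  scaled_qrook M l i n =1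
  foldr (row_op M) (fun k => (k == 0)%:R) [seq (l j + j)%N | j <- iota i n].
Proof.
move=> i0 ldec; elim: n i i0 => [|n IH] i i0 eM k /=.
  rewrite /scaled_qrook leqn0 /= qrook_fset0 muln0 !expr0 !mul1r.
  by case: eqP => [->|].
rewrite scaled_qrookS //; apply: eq_row_op; apply: IH => //.
by rewrite addSn -addnS.
Qed.

(** Functions are compared pointwise, hence the assumption that [op] respects [=1]. Commutation lets
    any entry be moved to the front. *)
Lemma perm_foldr_ext (T : eqType) (A B : Type) (op : T -> (A -> B) -> A -> B) :
    (forall x f g, f =1 g -> op x f =1 op x g) ->
    (forall x y f, op x (op y f) =1 op y (op x f)) ->
  forall s t f, perm_eq s t -> foldr op f s =1 foldr op f t.
Proof.
move=> op_ext opC s; have shift x t1 t2 f :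
    foldr op f (t1 ++ x :: t2) =1 op x (foldr op f (t1 ++ t2)).
  elim: t1 => [|y t1 IH] //= a.
  by rewrite (op_ext y _ _ IH) opC.
elim: s => [|x s IH] t f st; first by rewrite perm_sym in st; rewrite (perm_nilP st).
have xt : x \in t by rewrite -(perm_mem st) mem_head.
case/splitPr: t / xt st => t1 t2; rewrite -[x :: t2]cat1s perm_sym perm_catCA /= perm_cons perm_sym.
move=> st a; rewrite shift /=; apply: op_ext; exact: IH.
Qed.

Lemma eq_qrook_board l l' n r : antitone l -> antitone l' ->
    perm_eq [seq (l j + j)%N | j <- iota 1 n] [seq (l' j + j)%N | j <- iota 1 n] ->
  qrook (board l 1 n) r = qrook (board l' 1 n) r.
Proof.
move=> ldec ldec' ll'; have [rn|nr] := leqP r n; last by rewrite !qrook_gt_height.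
have e : scaled_qrook n.+1 l 1 n (n - r) = scaled_qrook n.+1 l' 1 n (n - r).
  rewrite !scaled_qrook_foldr //.
  apply: perm_foldr_ext ll' _; [exact: eq_row_op | exact: row_op_comm].
(* The scaling factor is nonzero in an integral domain and cancels. *)
move: e; rewrite /scaled_qrook leq_subr subKn // => /mulfI; apply.
by rewrite mulf_neq0 ?expf_neq0 ?polyX_eq0 // -[1]/(1%:P) polyXsubC_eq0.
Qed.

End RowOperators.

(** * Ferrers diagrams as boards *)

(* Taking the maximum over all rows from [i] on makes [row_len F] antitone at
   [0] too; for [i > 0] it is the length of row [i] of a Ferrers diagram. *)
Definition row_len (F : {fset nat * nat}) (i : nat) : nat :=
  \max_(p <- F | i <= p.1) p.2.

Lemma row_len_antitone F : antitone (row_len F).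
Proof.
move=> i j ij; apply/bigmax_leqP_seq => p pF jp.
by apply: (bigmaxn_sup_seq p) => //; apply: leq_trans ij jp.
Qed.

Lemma in_ferrers F i t : ferrers F -> 0 < i ->
  ((i, t) \in F) = (0 < t <= row_len F i).
Proof.
move=> [Fpos Fdown] i0; apply/idP/andP => [itF|[t0 tl]].
  split; first by case: (Fpos _ _ itF).
  exact: (bigmaxn_sup_seq (i, t)).
(* The maximum is either the default 0 or attained in some row [s >= i], from which the Ferrers
   property reaches [(i, t)]. *)
have [E|[s [is_ sF]]] : row_len F i = 0 \/ exists s, i <= s /\ (s, row_len F i) \in F.
- rewrite /row_len big_seq_cond.
  apply: (big_ind (fun m => m = 0 \/ exists s, i <= s /\ (s, m) \in F)).
  + by left.
  + by move=> m n Hm Hn; rewrite /maxn; case: ifP.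
  by move=> [s u] /andP[pF ip]; right; exists s.
- by rewrite E leqNgt t0 in tl.
by apply: Fdown sF _ _; [rewrite i0 | rewrite t0].
Qed.

(** Any bound [n] on the rows will do, as missing rows have length 0; this lets two diagrams share
    the same [n]. *)
Lemma ferrersE F n : ferrers F -> (forall p, p \in F -> p.1 <= n) ->
  F = board (row_len F) 1 n.
Proof.
move=> FF Fn; apply/fsetP => -[i t]; rewrite in_board /= add1n ltnS.
case: (posnP i) => [->|i0] /=.
  by apply/negP => itF; case: (FF.1 _ _ itF).
rewrite (in_ferrers _ FF i0); have [//|ni] := leqP i n.
rewrite -(in_ferrers _ FF i0); apply/negP => /Fn /=.
by rewrite leqNgt ni.
Qed.

(** * Diagonal sizes determine the multiset *)

Lemma card_diagonal F d :
  #|` diagonal d `&` F| = count (fun s => (s, d - s + 1) \in F) (iota 1 d).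
Proof.
rewrite -size_filter -(size_map (fun s => (s, d - s + 1))); apply: cardfs_uniq.
  by rewrite map_inj_uniq ?filter_uniq ?iota_uniq // => x y [].
move=> c; rewrite in_fsetI; apply/mapP/andP => [[s]|[/imfsetP[s /= sd ->] sF]].
  by rewrite mem_filter => /andP[sF sd] ->; split=> //; apply/imfsetP; exists s.
by exists s; rewrite // mem_filter sF.
Qed.

(* Cell [(s, d - s + 1)] lies in [F] iff [d < row_len F s + s]; for [s > d] the
   latter always holds. *)
Lemma count_row_len F n d : ferrers F -> (forall p, p \in F -> p.1 <= n) ->
  count (fun c => d < c) [seq row_len F j + j | j <- iota 1 n] =
    #|` diagonal d `&` F| + (n - d).
Proof.
move=> FF Fn; rewrite count_map card_diagonal.
have diagE : {in iota 1 d, (fun s => (s, d - s + 1) \in F) =1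
    preim (fun j => row_len F j + j) (fun c => d < c)}.
  move=> s; rewrite mem_iota => /andP[s0 sd]; rewrite /= in_ferrers //; lia.
rewrite (eq_in_count diagE); have [dn|nd] := leqP d n.
  rewrite -{1}(subnKC dn) iotaD count_cat; congr addn.
  rewrite -[RHS](size_iota (1 + d)); apply/eqP; rewrite -all_count.
  by apply/allP => j; rewrite mem_iota /=; lia.
rewrite (eqP (ltnW nd)) addn0 -[in iota 1 d](subnKC (ltnW nd)) iotaD count_cat -[LHS]addn0.
congr addn; apply/esym/eqP; rewrite -leqn0 leqNgt -has_count; apply/hasPn => j.
rewrite mem_iota => /andP[nj jd].
have /diagE/= <- : j \in iota 1 d by rewrite mem_iota; lia.
by apply/negP => /Fn /=; lia.
Qed.

(** The multiplicity of [d + 1] is the number of entries above [d] minus the number above [d + 1];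
    the counts do not see entries equal to 0. *)
Lemma perm_count_gt (s t : seq nat) :
  (forall d, count (fun c => d < c) s = count (fun c => d < c) t) ->
  0 \notin s -> 0 \notin t -> perm_eq s t.
Proof.
move=> st s0 t0; apply/allP => -[|d] _ /=.
  by rewrite !(count_memPn _).
have count_gtS u : count (fun c => d < c) u = count_mem d.+1 u + count (fun c => d.+1 < c) u.
  rewrite -count_predUI [X in _ = _ + X](eq_count (a2 := pred0)) ?count_pred0 ?addn0.
    by apply: eq_count => c /=; lia.
  by move=> c /=; lia.
by have := st d; rewrite !count_gtS st => /addIn ->.
Qed.

Lemma eq_qrook F F' r : ferrers F -> ferrers F' -> diag_equiv F F' ->
  qrook F r = qrook F' r.
Proof.
move=> FF FF' FF'eq.
pose n := \max_(p <- F `|` F') p.1.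
have Un p : p \in F `|` F' -> p.1 <= n.
  by move=> pU; apply: (bigmaxn_sup_seq p).
have Fn p : p \in F -> p.1 <= n by move=> pF; apply: Un; rewrite inE pF.
have F'n p : p \in F' -> p.1 <= n by move=> pF; apply: Un; rewrite inE pF orbT.
have pos (G : {fset nat * nat}) : 0 \notin [seq row_len G j + j | j <- iota 1 n].
  by apply/mapP => -[j]; rewrite mem_iota; lia.
rewrite (ferrersE FF Fn) (ferrersE FF' F'n); apply: eq_qrook_board.
- exact: row_len_antitone.
- exact: row_len_antitone.
apply: perm_count_gt => // d; rewrite !count_row_len //; congr addn.
(* [diag_equiv] covers only [d > 0]; diagonal 0 is empty. *)
by have [->|/FF'eq //] := posnP d; rewrite !card_diagonal.
Qed.

(** This turns equality of polynomials into equality of the placement counts. *)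
Lemma coef_qrook F r l :
  ((qrook F r)`_l = (#|` [fset P in NAR F r | rook_inv F P == l]|)%:R)%R.
Proof.
rewrite /qrook coef_sum (@cardfs_uniq _ _ [seq P <- NAR F r | rook_inv F P == l]).
- rewrite size_filter -sum1_count [in RHS]big_mkcond natr_sum /=.
  by apply: eq_bigr => P _; rewrite coefXn eq_sym; case: eqP.
- by rewrite filter_uniq.
by move=> P; rewrite mem_filter !inE andbC.
Qed.

Theorem theorem3p1 (F F' : {fset nat * nat}) (hF : ferrers F)
    (hF' : ferrers F') (hFF' : diag_equiv F F') :
  (forall r l : nat, 0 < l ->
     #|` [fset P in NAR F r | rook_inv F P == l]| =
     #|` [fset P in NAR F' r | rook_inv F' P == l]|) /\
  (forall r : nat, qrook F r = qrook F' r).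
Proof.
split=> [r l _|r]; last exact: eq_qrook.
have /eqP := coef_qrook F r l; rewrite (eq_qrook r hF hF' hFF') coef_qrook.
by rewrite Num.Theory.eqr_nat => /eqP.
Qed.
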